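(* Consider the model $Y_t=g_t(X_t,U_t)$, $t=1,2$, with $Y_t\in\mathbb{R}$, $X_t\in\mathbb{R}^k$, $U_t\in\mathbb{R}$, $\mathbf{X}=(X_1,X_2)$. Suppose: (D1) for $t=1,2$, $g_t(x,u)$ is weakly increasing in $u$ for all $x$, and $U_t$ given $\mathbf{X}=\mathbf{x}$ is continuously distributed for all $\mathbf{x}$; (D2) for $t=1,2$, $Y_t$ is discretely distributed; the supports $\mathcal{Y}_1,\mathcal{Y}_2$ of $Y_1,Y_2$ satisfy $\mathcal{Y}_1=\mathcal{Y}_2=\mathcal{Y}$, with $\underline{y}=\inf\mathcal{Y}$ and $\overline{y}=\sup\mathcal{Y}$; (D3) for $t=1,2$, the marginal distribution of $U_t$ is uniform on $[0,1]$; (D4) for all $\mathbf{x}\in\mathcal{X}_{12}$, the conditional distributions of $U_1$ and $U_2$ given $\mathbf{X}=\mathbf{x}$ coincide, and the support of $U_t$ given $\mathbf{X}=\mathbf{x}$ is $[0,1]$. If $\mathcal{X}_{12}=\mathcal{X}_1\times\mathcal{X}_2$, then for $t\in\{1,2\}$, all $x\in\mathcal{X}_t$ and all $u\in[0,1]$, $$g_t(x,u)\ge g_t^L(x,u):=\inf\{y\in[\underline{y},\overline{y}]:G^L_{t,x}(y)\ge u\},$$ $$g_t(x,u)\le g_t^U(x,u):=\sup\{y\in[\underline{y},\overline{y}]:G^U_{t,x}(y)\le u\},$$ where $G^L_{t,x}$ and $G^U_{t,x}$ are the functions of the distribution of $(Y_1,Y_2,X_1,X_2)$ defined in the context.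
   Context: $\mathcal{X}_t$, $\mathcal{X}_{12}$ are the supports of $X_t$ and $(X_1,X_2)$; $g_t:\mathcal{X}_t\times[0,1]\to\mathcal{Y}$. Conditional distributions are understood as fixed versions defined for every point of the support of the conditioning variable, compatible with the model (given $\mathbf{X}=(x_1,x_2)$, $Y_t=g_t(x_t,U_t)$). For random variables $V,W$: $F^+_{V|W}(v|w)=P(V\le v|W=w)$, $F^-_{V|W}(v|w)=P(V<v|W=w)$; also written $F^{\pm}_{V|W=w}(v)$. For $\mathbf{x}\in\mathcal{X}_{12}$, $$Q^+_{Y_t|\mathbf{X}=\mathbf{x}}(\tau)=\sup\{y\in[\underline{y},\overline{y}]:F^-_{Y_t|\mathbf{X}=\mathbf{x}}(y)\le\tau\},\qquad Q^-_{Y_t|\mathbf{X}=\mathbf{x}}(\tau)=\inf\{y\in[\underline{y},\overline{y}]:F^+_{Y_t|\mathbf{X}=\mathbf{x}}(y)\ge\tau\}.$$ For $\{t,s\}=\{1,2\}$ and $x_t\in\mathcal{X}_t$, $x_s\in\mathcal{X}_s$, $$\tilde T^{U,t,s}_{x_t,x_s}(y)=Q^+_{Y_t|(X_t,X_s)=(x_t,x_s)}\left(F^+_{Y_s|(X_t,X_s)=(x_t,x_s)}(y)\right),\qquad \tilde T^{L,t,s}_{x_t,x_s}(y)=Q^-_{Y_t|(X_t,X_s)=(x_t,x_s)}\left(F^-_{Y_s|(X_t,X_s)=(x_t,x_s)}(y)\right).$$ (For $\tilde T^{\cdot,s,t}_{x_s,x_t}$ the roles of $t$ and $s$ are exchanged.)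 For $x,x'\in\mathcal{X}_t$ and $s\neq t$, set $T^U_{t,x',x}(y)=\inf_{\tilde x\in\mathcal{X}_s}\tilde T^{U,t,s}_{x',\tilde x}\circ\tilde T^{U,s,t}_{\tilde x,x}(y)$ and $T^L_{t,x',x}(y)=\sup_{\tilde x\in\mathcal{X}_s}\tilde T^{L,t,s}_{x',\tilde x}\circ\tilde T^{L,s,t}_{\tilde x,x}(y)$ if $x\ne x'$, and $T^U_{t,x,x}(y)=T^L_{t,x,x}(y)=y$. Finally $$G^L_{t,x}(y)=\int F^+_{Y_t|X_t=x'}\left(T^U_{t,x',x}(y)\right)dF_{X_t}(x'),\qquad G^U_{t,x}(y)=\int F^-_{Y_t|X_t=x'}\left(T^L_{t,x',x}(y)\right)dF_{X_t}(x').$$ *)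

(* Defs.v *)
(* MathComp / MathComp-Analysis. *)
From HB Require Import structures.
From mathcomp Require Import all_boot all_order all_algebra.
From mathcomp Require Import all_classical all_reals all_analysis.

Set Implicit Arguments.
Unset Strict Implicit.
Unset Printing Implicit Defensive.

Import Order.TTheory GRing.Theory Num.Theory.
Import numFieldNormedType.Exports.

Local Open Scope classical_set_scope.
Local Open Scope ring_scope.

(* Borel sigma-algebra of the (entrywise) topology of matrices; it makes
   'rV[R]_k a measurable space. *)
HB.instance Definition _ (R : realType) (m n : nat) :=
  @isMeasurable.Build (sigma_display (@open 'M[R]_(m, n))) 'M[R]_(m, n)
    <<s @open 'M[R]_(m, n) >> (@sigma_algebra0 _ setT _) (@sigma_algebraC _ _)
    (@sigma_algebra_bigcup _ setT _).

(* The two periods are indexed by bool: false is period 1, true is period 2,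
   and ~~ t is the period other than t. *)

(* component of (a_1, a_2) at period t *)
Definition at_period (A : Type) (t : bool) (a : A * A) : A :=
  if t then a.2 else a.1.

(* the pair (a_1, a_2) with a_t = a and a_s = b, where s is the period other
   than t; the event (X_t, X_s) = (a, b) is (X_1, X_2) = pair_at t a b *)
Definition pair_at (A : Type) (t : bool) (a b : A) : A * A :=
  if t then (b, a) else (a, b).

Definition law_support (R : realType) (T : topologicalType)
    (mu : set T -> \bar R) : set T :=
  [set x | forall A, open A -> A x -> (0 < mu A)%E].

Definition continuous_law (R : realType) (mu : set R -> \bar R) : Prop :=
  continuous (fun v : R => fine (mu `]-oo, v]%classic)).

Definition discrete_law (R : realType) (mu : set R -> \bar R) : Prop :=
  exists2 D : set R, countable D & mu D = 1%E.

(* kappa is a version of the conditional distribution of V given W.  It is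
   defined for every value of W; its values off the support of W are
   irrelevant. *)
Definition is_cond_law d d1 d2 (T : measurableType d) (R : realType)
    (P : probability T R) (TV : measurableType d1) (TW : measurableType d2)
    (V : T -> TV) (W : T -> TW) (kappa : R.-pker TW ~> TV) : Prop :=
  forall A B, measurable A -> measurable B ->
    P (V @^-1` A `&` W @^-1` B) = (\int[P]_(w in W @^-1` B) kappa (W w) A)%E.

(* F^+ (y) and F^- (y) for the law mu of a real random variable.  The argument
   is extended-real because the infimum or supremum of the support of the
   outcome may be infinite. *)
Definition Fplus (R : realType) (mu : set R -> \bar R) (y : \bar R) : \bar R :=
  mu [set v : R | (v%:E <= y)%E].

Definition Fminus (R : realType) (mu : set R -> \bar R) (y : \bar R) : \bar R :=
  mu [set v : R | (v%:E < y)%E].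

(* Q^+ and Q^- over the interval [ylo, yhi] of the extended real line *)
Definition Qplus (R : realType) (ylo yhi : \bar R) (mu : set R -> \bar R)
    (tau : \bar R) : \bar R :=
  ereal_sup [set y | (ylo <= y <= yhi)%E /\ (Fminus mu y <= tau)%E].

Definition Qminus (R : realType) (ylo yhi : \bar R) (mu : set R -> \bar R)
    (tau : \bar R) : \bar R :=
  ereal_inf [set y | (ylo <= y <= yhi)%E /\ (tau <= Fplus mu y)%E].

(* In what follows LY t x is the law of Y_t given (X_1, X_2) = x, LYm t x the
   law of Y_t given X_t = x, and SX t the support of X_t. *)

(* \tilde T^{U,t,s}_{xt,xs} and \tilde T^{L,t,s}_{xt,xs}, with s = ~~ t *)
Definition tildeTU (R : realType) (E : Type) (ylo yhi : \bar R)
    (LY : bool -> E * E -> set R -> \bar R) (t : bool) (xt xs : E)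
    (y : \bar R) : \bar R :=
  Qplus ylo yhi (LY t (pair_at t xt xs))
    (Fplus (LY (~~ t) (pair_at t xt xs)) y).

Definition tildeTL (R : realType) (E : Type) (ylo yhi : \bar R)
    (LY : bool -> E * E -> set R -> \bar R) (t : bool) (xt xs : E)
    (y : \bar R) : \bar R :=
  Qminus ylo yhi (LY t (pair_at t xt xs))
    (Fminus (LY (~~ t) (pair_at t xt xs)) y).

(* T^U_{t,x',x} and T^L_{t,x',x} *)
Definition TU (R : realType) (E : eqType) (ylo yhi : \bar R)
    (LY : bool -> E * E -> set R -> \bar R) (SX : bool -> set E)
    (t : bool) (x' x : E) (y : \bar R) : \bar R :=
  if x' == x then y
  else ereal_inf [set tildeTU ylo yhi LY t x' xs
                        (tildeTU ylo yhi LY (~~ t) xs x y) | xs in SX (~~ t)].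

Definition TL (R : realType) (E : eqType) (ylo yhi : \bar R)
    (LY : bool -> E * E -> set R -> \bar R) (SX : bool -> set E)
    (t : bool) (x' x : E) (y : \bar R) : \bar R :=
  if x' == x then y
  else ereal_sup [set tildeTL ylo yhi LY t x' xs
                        (tildeTL ylo yhi LY (~~ t) xs x y) | xs in SX (~~ t)].

(* G^L_{t,x} and G^U_{t,x}, where PX t is the law of X_t.  The integral is over
   the support of X_t, where the conditional law LYm t is meaningful. *)
Definition GL (R : realType) d (E : measurableType d) (ylo yhi : \bar R)
    (LY : bool -> E * E -> set R -> \bar R) (LYm : bool -> E -> set R -> \bar R)
    (SX : bool -> set E) (PX : bool -> {measure set E -> \bar R})
    (t : bool) (x : E) (y : \bar R) : \bar R :=
  (\int[PX t]_(x' in SX t) Fplus (LYm t x') (TU ylo yhi LY SX t x' x y))%E.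

Definition GU (R : realType) d (E : measurableType d) (ylo yhi : \bar R)
    (LY : bool -> E * E -> set R -> \bar R) (LYm : bool -> E -> set R -> \bar R)
    (SX : bool -> set E) (PX : bool -> {measure set E -> \bar R})
    (t : bool) (x : E) (y : \bar R) : \bar R :=
  (\int[PX t]_(x' in SX t) Fminus (LYm t x') (TL ylo yhi LY SX t x' x y))%E.

(* g^L_t (x, u) and g^U_t (x, u), from G = G^L_{t,x} and G = G^U_{t,x} *)
Definition lower_bound_of (R : realType) (ylo yhi : \bar R)
    (G : \bar R -> \bar R) (u : R) : \bar R :=
  ereal_inf [set y | (ylo <= y <= yhi)%E /\ (u%:E <= G y)%E].

Definition upper_bound_of (R : realType) (ylo yhi : \bar R)
    (G : \bar R -> \bar R) (u : R) : \bar R :=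
  ereal_sup [set y | (ylo <= y <= yhi)%E /\ (G y <= u%:E)%E].

(* Main.v *)
(* Fix u and write q_t(x) = g_t(x, u).  Given (X_1, X_2) = (x_1, x_2), the
   latent variables of both periods have the same law, carried by [0, 1], so by
   monotonicity
     P(Y_t < q_t(x_t)) <= P(U_t < u) <= P(U_s <= u) <= P(Y_s <= q_s(x_s)).
   Hence the map T^U from period s to period t sends values above q_s(x_s) to
   values above q_t(x_t), and T^L sends values below q_s(x_s) to values below
   q_t(x_t).  Going through period s and back, T^U_{t,x',x}(q_t(x)) >= q_t(x')
   for every x', so the integrand of G^L at q_t(x) is at least
   P(U_t <= u | X_t = x'), whose mean over X_t is u.  Thus q_t(x) belongs to the
   set whose infimum is the lower bound; the upper bound is dual. *)
Require Import Defs.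
From HB Require Import structures.
From mathcomp Require Import lra.
From mathcomp Require Import all_boot all_order all_algebra.
From mathcomp Require Import all_classical all_reals all_analysis.

Set Implicit Arguments.
Unset Strict Implicit.
Unset Printing Implicit Defensive.

Import Order.TTheory GRing.Theory Num.Theory.
Import numFieldNormedType.Exports.

Local Open Scope classical_set_scope.
Local Open Scope ring_scope.

(** * Supports of laws and their null complements *)

Lemma open_setC_law_support (R : realType) (T : topologicalType)
    (mu : set T -> \bar R) : open (~` law_support mu).
Proof.
rewrite openE => x /existsNP[A /not_implyP[oA /not_implyP[Ax muA]]].
rewrite /interior; near=> y; apply/existsNP; exists A.
apply/not_implyP; split=> //; apply/not_implyP; split=> //.
by near: y; exact: open_nbhs_nbhs.
Unshelve. all: by end_near. Qed.

(* The null sets among the countably many balls with centre in the range of q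
   and radius 1 / (n + 1) cover the complement of the support. *)
Lemma law_support_setC_eq0 d (S : measurableType d) (R : realType)
    (T : pseudoMetricType R) (I : countType) (q : I -> T)
    (nu : {measure set S -> \bar R}) (f : S -> T) :
  (forall x e, 0 < e -> exists i, ball (q i) e x) ->
  (forall A, open A -> measurable (f @^-1` A)) ->
  nu (f @^-1` (~` law_support (fun A => nu (f @^-1` A)))) = 0%E.
Proof.
move=> qdense mf; pose mu A := nu (f @^-1` A).
(* Balls of a pseudometric need not be open; their interiors are, so [mf] applies. *)
pose B (p : I * nat) := interior (ball (q p.1) (p.2.+1%:R^-1)).
have mB p : measurable (f @^-1` B p) by apply/mf/open_interior.
(* Enumeration of the null [B p]; every other index is sent to [set0]. *)
pose F n : set T := if unpickle n is Some p then
  if mu (B p) == 0%E then B p else set0 else set0.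
apply: measure_negligible; first by apply/mf/open_setC_law_support.
apply: (@negligibleS _ _ _ _ (\bigcup_n (f @^-1` F n))); last first.
  apply: negligible_bigcup => n; rewrite /F; case: unpickle => [p|]; last first.
    by rewrite preimage_set0; exact: negligible_set0.
  case: ifP => [/eqP mup|_]; first exact/negligibleP.
  by rewrite preimage_set0; exact: negligible_set0.
move=> s /existsNP[A /not_implyP[oA /not_implyP[Ax /negP]]].
rewrite lt0e measure_ge0 andbT negbK => /eqP muA.
have /nbhs_ballP[e /= e0 eA] : nbhs (f s) A by exact: open_nbhs_nbhs.
have e20 : 0 < e / 2 by rewrite divr_gt0.
have [n _ /(_ n (leqnn n)) /= ne] := near_infty_natSinv_lt (PosNum e20).
set r : R := n.+1%:R^-1 in ne; have r0 : 0 < r by rewrite invr_gt0.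
have r20 : 0 < r / 2 by rewrite divr_gt0.
(* A centre within [r / 2] of [f s] puts [f s] in the interior of the ball of radius [r], and
   [r < e / 2] keeps that ball inside [A]. *)
have [i ix] := qdense (f s) (r / 2) r20.
have rr : r = r / 2 + r / 2 by rewrite -splitr.
have Bs : B (i, n) (f s).
  apply/nbhs_ballP; exists (r / 2) => //.
  by move=> y sy; rewrite -/r rr; exact: ball_triangle ix sy.
have BA : B (i, n) `<=` A.
  move=> y /interior_subset /= iy; apply: eA; rewrite (splitr e).
  apply: (@ball_triangle _ _ (q i)).
    by apply/ball_sym/(le_ball _ ix); move: ne r0; lra.
  exact: le_ball (ltW ne) _ iy.
have muB : mu (B (i, n)) = 0%E.
  apply/eqP; rewrite eq_le measure_ge0 andbT -[leRHS]muA.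
  by apply: le_measure; rewrite ?inE//; [exact: mf|move=> z /BA].
by exists (pickle (i, n)) => //=; rewrite /F pickleK muB eqxx.
Qed.

Lemma ratr_dense (R : realType) (x e : R) : 0 < e ->
  exists i : rat, ball (ratr i : R) e x.
Proof.
move=> e0; have [|i] := @rat_in_itvoo _ (x - e) (x + e); first lra.
rewrite in_itv/= => ie; exists i; rewrite /ball/= ltr_distlC.
move: ie; lra.
Qed.

(** Balls of matrices are entrywise, so each entry is approximated separately. Rational matrices
    form a countable type and can serve as centres in [law_support_setC_eq0]. *)
Lemma map_mx_ratr_dense (R : realType) m n (x : 'M[R]_(m, n)) (e : R) : 0 < e ->
  exists i : 'M[rat]_(m, n), ball (map_mx ratr i : 'M[R]_(m, n)) e x.
Proof.
move=> e0.
have /choice[i ie] (kl : 'I_m * 'I_n) := ratr_dense (x kl.1 kl.2) e0.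
exists (\matrix_(k, l) i (k, l)); split=> // k l.
by rewrite !mxE; exact: (ie (k, l)).
Qed.


(* No measurability is needed: the integral of a nonnegative function is a
   supremum over the simple functions below it.  The maps [TU] and [TL] are
   extrema over a possibly uncountable set, so that the integrands of [GL] and
   [GU] need not be measurable. *)
Lemma nonneg_le_integral d (T : measurableType d) (R : realType)
    (mu : {measure set T -> \bar R}) (D : set T) (f h : T -> \bar R) :
  (forall x, D x -> 0 <= f x)%E -> (forall x, D x -> f x <= h x)%E ->
  (\int[mu]_(x in D) f x <= \int[mu]_(x in D) h x)%E.
Proof.
move=> f0 fh; have h0 x : D x -> (0 <= h x)%E.
  by move=> Dx; rewrite (le_trans (f0 _ Dx)) ?fh.
rewrite !ge0_integralE//; apply: le_ereal_sup => _ /= [s sf <-].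
exists s => // x; rewrite (le_trans (sf x))// /patch.
by case: ifPn => // /set_mem /fh.
Qed.

(** The null set outside which [C] holds, added to [B], covers [A]. *)
Lemma ae_le_measure d (T : measurableType d) (R : realType)
    (mu : {measure set T -> \bar R}) (A B : set T) (C : T -> Prop) :
  measurable A -> measurable B -> {ae mu, forall x, C x} ->
  A `&` C `<=` B -> (mu A <= mu B)%E.
Proof.
move=> mA mB [N [mN N0 CN]] ACB.
rewrite -[leRHS]adde0 -N0; apply: (le_trans _ (measureU2 _ _ _)) => //.
apply: le_measure; rewrite ?inE//; first exact: measurableU.
move=> x Ax; have [Cx|nCx] := pselect (C x); first by left; apply: ACB.
by right; apply: CN.
Qed.

Lemma measurable_preimage d d' (S : measurableType d) (T : measurableType d')
    (f : S -> T) (A : set T) :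
  measurable_fun setT f -> measurable A -> measurable (f @^-1` A).
Proof. by move=> mf mA; rewrite -[X in measurable X]setTI; exact: mf. Qed.

Lemma measurable_le_set (R : realType) (y : \bar R) :
  measurable [set v : R | (v%:E <= y)%E].
Proof.
rewrite -[X in measurable X]setTI.
by apply: emeasurable_fun_le => //; exact/measurable_EFinP.
Qed.

Lemma measurable_lt_set (R : realType) (y : \bar R) :
  measurable [set v : R | (v%:E < y)%E].
Proof.
rewrite -[X in measurable X]setTI.
by apply: emeasurable_fun_lt => //; exact/measurable_EFinP.
Qed.

(** * Outcome distributions compared with the latent law *)

Section outcome_law.
Context (R : realType).
Implicit Types (kappa : {measure set (R * R) -> \bar R}) (h : R -> R).

Lemma le_Fplus kappa y z : (y <= z)%E ->
  (Fplus (pushforward kappa fst) y <= Fplus (pushforward kappa fst) z)%E.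
Proof.
move=> yz; rewrite /Fplus /pushforward; apply: le_measure; rewrite ?inE.
- by apply: measurable_preimage => //; exact: measurable_le_set.
- by apply: measurable_preimage => //; exact: measurable_le_set.
- by move=> v /= vy; exact: le_trans vy yz.
Qed.

Lemma le_Fminus kappa y z : (y <= z)%E ->
  (Fminus (pushforward kappa fst) y <= Fminus (pushforward kappa fst) z)%E.
Proof.
move=> yz; rewrite /Fminus /pushforward; apply: le_measure; rewrite ?inE.
- by apply: measurable_preimage => //; exact: measurable_lt_set.
- by apply: measurable_preimage => //; exact: measurable_lt_set.
- by move=> v /= vy; exact: lt_le_trans vy yz.
Qed.

Lemma snd_itv_le_Fplus kappa h u :
  {ae kappa, forall yu, yu.1 = h yu.2} ->
  (forall v w, 0 <= v -> v <= w -> w <= 1 -> h v <= h w) -> 0 <= u <= 1 ->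
  (kappa (@snd R R @^-1` `[0%R, u]%classic) <=
    Fplus (pushforward kappa fst) (h u)%:E)%E.
Proof.
move=> hae hmono /andP[u0 u1]; apply: (ae_le_measure _ _ hae).
- exact: measurable_preimage.
- by apply: measurable_preimage => //; exact: measurable_le_set.
- move=> [y v] /= [+ ->]; rewrite in_itv/= lee_fin => /andP[v0 vu].
  exact: hmono.
Qed.

(** Contrapositive of monotonicity on [[u, 1]]. The bound is a complement rather than [[0, u[]
    because [h] is not controlled outside [[0, 1]]. *)
Lemma Fminus_le_snd_itvC kappa h u :
  {ae kappa, forall yu, yu.1 = h yu.2} ->
  (forall v w, 0 <= v -> v <= w -> w <= 1 -> h v <= h w) -> 0 <= u <= 1 ->
  (Fminus (pushforward kappa fst) (h u)%:E <=
    kappa (@snd R R @^-1` (~` `[u, 1%R])))%E.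
Proof.
move=> hae hmono /andP[u0 u1]; apply: (ae_le_measure _ _ hae).
- by apply: measurable_preimage => //; exact: measurable_lt_set.
- by apply: measurable_preimage => //; exact: measurableC.
- move=> [y v] /= [+ yv]; rewrite yv in_itv/= lte_fin => hvu /andP[uv v1].
  by have := hmono _ _ u0 uv v1; rewrite leNgt hvu.
Qed.

(* When the two periods share the law of the latent variable, its quantile of
   rank u sits at h u in one period and at h' u in the other. *)
Lemma Fminus_le_Fplus kappa kappa' h h' u :
  {ae kappa, forall yu, yu.1 = h yu.2} ->
  {ae kappa', forall yu, yu.1 = h' yu.2} ->
  (forall v w, 0 <= v -> v <= w -> w <= 1 -> h v <= h w) ->
  (forall v w, 0 <= v -> v <= w -> w <= 1 -> h' v <= h' w) ->
  (forall A, measurable A -> kappa (snd @^-1` A) = kappa' (snd @^-1` A)) ->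
  kappa (@snd R R @^-1` (~` `[0%R, 1%R])) = 0%E -> 0 <= u <= 1 ->
  (Fminus (pushforward kappa fst) (h u)%:E <=
    Fplus (pushforward kappa' fst) (h' u)%:E)%E.
Proof.
move=> hae h'ae hmono h'mono kk' k0 u01.
apply: le_trans (snd_itv_le_Fplus h'ae h'mono u01); rewrite -kk'//.
apply: le_trans (Fminus_le_snd_itvC hae hmono u01) _.
have msnd (A : set R) : measurable A -> measurable (snd @^-1` A : set (R * R)).
  exact: measurable_preimage.
(* The complement of [[u, 1]] is covered by [[0, u]] and the null complement of [[0, 1]]. *)
rewrite -[leRHS]adde0 -k0; apply: (le_trans _ (measureU2 _ _ _)) => //;
  try by apply: msnd => //; exact: measurableC.
apply: le_measure; rewrite ?inE.
- by apply: msnd; exact: measurableC.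
- by apply: measurableU; apply: msnd => //; exact: measurableC.
move=> [y v] /=; rewrite !in_itv/=; case/andP: u01 => u0 u1 uv1.
have [v01|/negP v01] := boolP (0 <= v <= 1); [left|by right].
case/andP: v01 => v0 v1; rewrite v0 /= leNgt; apply/negP => uv.
by apply: uv1; rewrite ltW.
Qed.

End outcome_law.

(** * Quantile maps against a family of thresholds [gamma] *)

Section quantile_maps.
Context (R : realType) (E : eqType) (ylo yhi : \bar R).
Context (LY : bool -> E * E -> set R -> \bar R) (SX : bool -> set E).
Context (gamma : bool -> E -> \bar R).
Context (Fplus_homo : forall t x y z, (y <= z)%E ->
  (Fplus (LY t x) y <= Fplus (LY t x) z)%E).
Context (Fminus_homo : forall t x y z, (y <= z)%E ->
  (Fminus (LY t x) y <= Fminus (LY t x) z)%E).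
Context (gamma_range : forall t x, SX t x -> (ylo <= gamma t x <= yhi)%E).
Context (Fminus_le_Fplus_gamma : forall t a b, SX t a -> SX (~~ t) b ->
  (Fminus (LY t (pair_at t a b)) (gamma t a) <=
    Fplus (LY (~~ t) (pair_at t a b)) (gamma (~~ t) b))%E).

(** [gamma t a] itself belongs to the set whose supremum is [Qplus]. *)
Lemma tildeTU_ge t a b y : SX t a -> SX (~~ t) b -> (gamma (~~ t) b <= y)%E ->
  (gamma t a <= tildeTU ylo yhi LY t a b y)%E.
Proof.
move=> ta tb by_; apply: ereal_sup_ubound; split; first exact: gamma_range.
exact: le_trans (Fminus_le_Fplus_gamma ta tb) (Fplus_homo _ _ by_).
Qed.

Lemma tildeTL_le t a b y : SX t a -> SX (~~ t) b -> (y <= gamma (~~ t) b)%E ->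
  (tildeTL ylo yhi LY t a b y <= gamma t a)%E.
Proof.
move=> ta tb yb; apply: ereal_inf_lbound; split; first exact: gamma_range.
apply: le_trans (Fminus_homo _ _ yb) _.
(* The hypothesis is used with the periods exchanged; [pair_at (~~ t) b a] and [pair_at t a b] agree
   for each value of [t]. *)
have := @Fminus_le_Fplus_gamma (~~ t) b a tb; rewrite negbK => /(_ ta).
by case: (t).
Qed.

Lemma TU_ge t x' x : SX t x' -> SX t x ->
  (gamma t x' <= TU ylo yhi LY SX t x' x (gamma t x))%E.
Proof.
move=> tx' tx; rewrite /TU; case: eqP => [->//|_].
apply: le_ereal_inf_tmp => _ [xs txs <-]; apply: tildeTU_ge => //.
(* The inner map goes from [gamma t x] to a value above [gamma (~~ t) xs], as the outer one
   requires. *)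
by apply: tildeTU_ge; rewrite ?negbK.
Qed.

Lemma TL_le t x' x : SX t x' -> SX t x ->
  (TL ylo yhi LY SX t x' x (gamma t x) <= gamma t x')%E.
Proof.
move=> tx' tx; rewrite /TL; case: eqP => [->//|_].
apply: ge_ereal_sup => _ [xs txs <-]; apply: tildeTL_le => //.
by apply: tildeTL_le; rewrite ?negbK.
Qed.

End quantile_maps.

(** * Uniform masses and averages of conditional laws *)

Lemma uniform_prob01E (R : realType) (A : set R) : measurable A ->
  uniform_prob (@ltr01 R) A = lebesgue_measure (A `&` `[0, 1]).
Proof.
move=> mA; rewrite /uniform_prob integral_uniform_pdf.
rewrite (eq_integral (cst 1%E)); last first.
  move=> x; rewrite inE/= in_itv/= => -[_ x01].
  by rewrite /uniform_pdf x01 subr0 invr1.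
by rewrite integral_cst ?mul1e//; exact: measurableI.
Qed.

Lemma uniform_prob01_itv0 (R : realType) (u : R) : 0 <= u <= 1 ->
  uniform_prob (@ltr01 R) `[0, u] = u%:E.
Proof.
move=> /andP[u0 u1]; rewrite uniform_prob01E//.
rewrite setIidl; last by apply: subset_itvl; rewrite bnd_simp.
rewrite lebesgue_measure_itv/= lte_fin oppr0 adde0.
by case: ltP => // u0'; apply/eqP;
  rewrite eq_le !lee_fin u0.
Qed.

Lemma uniform_prob01_itvC1 (R : realType) (u : R) : 0 <= u <= 1 ->
  uniform_prob (@ltr01 R) (~` `[u, 1]) = u%:E.
Proof.
move=> /andP[u0 u1]; rewrite uniform_prob01E//; last exact: measurableC.
have -> : ~` `[u, 1] `&` `[0, 1] = `[0, u[%classic :> set R.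
  apply/seteqP; split=> x /=; rewrite !in_itv/=.
    move=> [ux /andP[x0 x1]]; rewrite x0 ltNge.
    by apply/negP => ux'; apply: ux; rewrite ux'.
  move=> /andP[x0 xu]; rewrite x0 (le_trans (ltW xu) u1); split=> //.
  by rewrite leNgt xu.
rewrite lebesgue_measure_itv/= lte_fin oppr0 adde0.
by case: ltP => // u0'; apply/eqP;
  rewrite eq_le !lee_fin u0.
Qed.

Lemma integral_distribution_cond_law d d1 d2 (T : measurableType d)
    (R : realType) (P : probability T R) (TV : measurableType d1)
    (TW : measurableType d2) (V : T -> TV) (W : {RV P >-> TW})
    (kappa : R.-pker TW ~> TV) A B :
  is_cond_law P V W kappa -> measurable A -> measurable B ->
  (\int[distribution P W]_(w in B) kappa w A)%E =
    P (V @^-1` A `&` W @^-1` B).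
Proof.
move=> VW mA mB; rewrite VW// ge0_integral_pushforward//.
by apply: measurable_funS (measurable_kernel kappa A mA).
Qed.

Theorem theorem5 (R : realType) (k : nat) (d : measure_display)
  (T : measurableType d) (P : probability T R)
  (X : bool -> {RV P >-> 'rV[R]_k}) (Y U : bool -> {RV P >-> R})
  (g : bool -> 'rV[R]_k -> R -> R)
  (* conditional laws of (Y_t, U_t) given (X_1, X_2), and given X_t *)
  (K : bool -> R.-pker ('rV[R]_k * 'rV[R]_k)%type ~> (R * R)%type)
  (Km : bool -> R.-pker 'rV[R]_k ~> (R * R)%type)
  (YY : set R) :
  let SX t := law_support (distribution P (X t)) in
  let SX12 := law_support (pushforward P (fun w => (X false w, X true w))) in
  let ylo := ereal_inf [set y%:E | y in YY] in
  let yhi := ereal_sup [set y%:E | y in YY] in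
  let LY t x := pushforward (K t x) fst in
  let LU t x := pushforward (K t x) snd in
  let LYm t x := pushforward (Km t x) fst in
  let PX t := distribution P (X t) in
  (* the model *)
  (forall t x u, SX t x -> 0 <= u <= 1 -> YY (g t x u)) ->
  (forall t, {ae P, forall w, Y t w = g t (X t w) (U t w)}) ->
  (* versions of the conditional distributions, compatible with the model *)
  (forall t, is_cond_law P (fun w => (Y t w, U t w))
               (fun w => (X false w, X true w)) (K t)) ->
  (forall t, is_cond_law P (fun w => (Y t w, U t w)) (X t) (Km t)) ->
  (forall t x, SX12 x ->
     {ae K t x, forall yu, yu.1 = g t (at_period t x) yu.2}) ->
  (forall t x, SX t x -> {ae Km t x, forall yu, yu.1 = g t x yu.2}) ->
  (* D1 *)
  (forall t x u v, SX t x -> 0 <= u -> u <= v -> v <= 1 ->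
     g t x u <= g t x v) ->
  (forall t x, SX12 x -> continuous_law (LU t x)) ->
  (* D2 *)
  (forall t, discrete_law (distribution P (Y t))) ->
  (forall t, law_support (distribution P (Y t)) = YY) ->
  (* D3 *)
  (forall t A, measurable A ->
     distribution P (U t) A = uniform_prob (@ltr01 R) A) ->
  (* D4 *)
  (forall x A, SX12 x -> measurable A -> LU false x A = LU true x A) ->
  (forall t x, SX12 x -> law_support (LU t x) = `[0, 1]%classic) ->
  SX12 = SX false `*` SX true ->
  forall t x u, SX t x -> 0 <= u <= 1 ->
    (lower_bound_of ylo yhi (GL ylo yhi LY LYm SX PX t x) u <= (g t x u)%:E)%E
    /\
    ((g t x u)%:E <= upper_bound_of ylo yhi (GU ylo yhi LY LYm SX PX t x) u)%E.
Proof.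
move=> SX SX12 ylo yhi LY LU LYm PX gYY _ _ KmP Kae Kmae gmono _ _ _ Uunif Ueq.
move=> Usupp SXE t x u tx u01.
pose gamma t x : \bar R := (g t x u)%:E.
(* The product form of the joint support makes every intermediate covariate value admissible. *)
have in12 s a b : SX s a -> SX (~~ s) b -> SX12 (pair_at s a b).
  by rewrite SXE; case: s => /= sa sb; split.
have gmono' s a : SX s a ->
    forall v w, 0 <= v -> v <= w -> w <= 1 -> g s a v <= g s a w.
  by move=> sa v w; exact: gmono.
have gamma_range s a : SX s a -> (ylo <= gamma s a <= yhi)%E.
  move=> sa; apply/andP; split.
    by apply: ereal_inf_lbound; exists (g s a u) => //; exact: gYY.
  by apply: ereal_sup_ubound; exists (g s a u) => //; exact: gYY.
have LU01 s p : SX12 p -> LU s p (~` `[0, 1]%classic) = 0%E.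
  move=> p12; rewrite -(Usupp s p p12).
  have /= := @law_support_setC_eq0 _ _ R R _ _ (K s p) snd (@ratr_dense R).
  apply => A oA.
  apply: measurable_preimage => //.
  exact: measurable_realfun.open_measurable.
have Fcmp s a b : SX s a -> SX (~~ s) b ->
    (Fminus (LY s (pair_at s a b)) (gamma s a) <=
     Fplus (LY (~~ s) (pair_at s a b)) (gamma (~~ s) b))%E.
  move=> sa sb; have p12 := in12 _ _ _ sa sb.
  apply: Fminus_le_Fplus (gmono' _ _ sa) (gmono' _ _ sb) _ _ u01.
  - by have := Kae s _ p12; case: (s).
  - by have := Kae (~~ s) _ p12; case: (s).
  - move=> A mA; have := Ueq _ A p12 mA; rewrite /LU /pushforward.
    by case: (s) => ->.
  - exact: LU01.
have Fplus_homo s p y z (yz : (y <= z)%E) :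
  (Fplus (LY s p) y <= Fplus (LY s p) z)%E by exact: le_Fplus.
have Fminus_homo s p y z (yz : (y <= z)%E) :
  (Fminus (LY s p) y <= Fminus (LY s p) z)%E by exact: le_Fminus.
have mX s A : open A -> measurable (X s @^-1` A).
  by move=> oA; apply: measurable_funPTI => //; exact: sub_sigma_algebra.
have SXC0 s : P (X s @^-1` (~` SX s)) = 0%E.
  exact: (@law_support_setC_eq0 _ _ _ _ _ _ P (X s)
    (@map_mx_ratr_dense R 1 k) (mX s)).
have mSX s : measurable (SX s).
  rewrite -[SX s]setCK; apply: measurableC; apply: sub_sigma_algebra.
  exact: open_setC_law_support.
have msnd A : measurable A -> measurable (@snd R R @^-1` A).
  exact: measurable_preimage.
have mU s A : measurable A -> measurable (U s @^-1` A).
  exact: measurable_funPTI.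
(* Law of total probability: [X s] lies in [SX s] almost surely, so averaging over the support
   recovers the uniform marginal of [U s]. *)
have KmE s A : measurable A ->
    (\int[PX s]_(a in SX s) Km s a (snd @^-1` A))%E =
    uniform_prob (@ltr01 R) A.
  move=> mA; rewrite (integral_distribution_cond_law (KmP s) (msnd _ mA))//.
  rewrite -(Uunif s)//; apply/eqP; rewrite eq_le; apply/andP; split.
    apply: le_measure; rewrite ?inE; [|exact: mU|by move=> w []].
    by apply: measurableI; [exact: mU|exact: measurable_funPTI].
  apply: (@ae_le_measure _ _ _ P _ _ (fun w => SX s (X s w))) => //.
  - exact: mU.
  - by apply: measurableI; [exact: mU|exact: measurable_funPTI].
  - exists (X s @^-1` (~` SX s)); split.
    + by apply: measurable_funPTI => //; exact: measurableC.
    + exact: SXC0.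
    + by [].
split.
- apply: ereal_inf_lbound; split; first exact: gamma_range.
  (* Writing [u] as the average of the conditional masses of [[0, u]] reduces the claim to a
     pointwise comparison of integrands. *)
  rewrite -(uniform_prob01_itv0 u01) -(KmE t)//.
  apply: nonneg_le_integral => // a ta.
  apply: le_trans (snd_itv_le_Fplus (Kmae _ _ ta) (gmono' _ _ ta) u01) _.
  apply: le_Fplus.
  exact: (@TU_ge _ _ ylo yhi LY SX gamma).
- apply: ereal_sup_ubound; split; first exact: gamma_range.
  (* Here [u] is the uniform mass of the complement of [[u, 1]], the set that bounds [Fminus]. *)
  rewrite -(uniform_prob01_itvC1 u01) -(KmE t)//; last exact: measurableC.
  apply: nonneg_le_integral => a ta; first exact: (measure_ge0 (Km t a)).
  apply: (le_trans _
    (Fminus_le_snd_itvC (Kmae _ _ ta) (gmono' _ _ ta) u01)).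
  apply: le_Fminus.
  exact: (@TL_le _ _ ylo yhi LY SX gamma).
Qed.
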